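(* Let $\varphi$ be a CNF formula over a finite set $X$ of Boolean variables and let $W: X \times \{0,1\} \rightarrow \mathbb{R}$ be a weight function. One can construct, in time polynomial in the size of $\varphi$, a tensor network $N_\varphi$ such that $N_\varphi$ has no free indices (i.e. $\mathcal{F}(N_\varphi) = \emptyset$) and the contraction of $N_\varphi$ (a rank-0 tensor, i.e. a scalar) equals the weighted model count $W(\varphi)$.
   Context: Indices: each index $i$ has a finite domain $[i]$. For a finite set $I$ of indices, $[I]$ is the set of assignments $\tau$ mapping each $i \in I$ to an element of $[i]$. A tensor $A$ over a finite set of indices $\mathcal{I}(A)$ is a function $A: [\mathcal{I}(A)] \rightarrow \mathbb{C}$; its rank is $|\mathcal{I}(A)|$. A tensor network $N$ is a nonempty finite set of tensors in which no index appears (as an index of a tensor) more than twice. Free indices $\mathcal{F}(N)$ are those appearing exactly once, bond indices $\mathcal{B}(N)$ those appearing exactly twice. The contraction of $N$ is the tensor $\mathcal{T}(N): [\mathcal{F}(N)] \rightarrow \mathbb{C}$ given by $\mathcal{T}(N)(\tau) = \sum_{\rho \in [\mathcal{B}(N)]} \prod_{A \in N} A((\rho \cup \tau)|_{\mathcal{I}(A)})$. The weighted model count of a formula $\varphi$ over Boolean variables $X$ w.r.t. $W: X \times \{0,1\}\to\mathbb{R}$ is $W(\varphi) = \sum_{\tau \in [X]} \varphi(\tau) \cdot \prod_{x \in X} W(x, \tau(x))$, where $[X]$ is the set of all functions $X \to \{0,1\}$ and $\varphi(\tau)\in\{0,1\}$ is the truth value of $\varphi$ under $\tau$. *)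

(* Defs.v *)
From HB Require Import structures.
From mathcomp Require Import all_boot all_order all_algebra.
From mathcomp Require Import finmap complex reals.

Set Implicit Arguments.
Unset Strict Implicit.
Unset Printing Implicit Defensive.

Import GRing.Theory.

Local Open Scope ring_scope.
Local Open Scope fset_scope.

Definition assignment (Ix : choiceType) (dom : Ix -> finType) (I : {fset Ix}) :
  finType := {dffun forall i : I, dom (val i)}.

Definition tensor_on (R : realType) (Ix : choiceType) (dom : Ix -> finType)
  (I : {fset Ix}) : choiceType := {ffun assignment dom I -> R[i]}.

Definition tensor (R : realType) (Ix : choiceType) (dom : Ix -> finType) :
  choiceType := {I : {fset Ix} & tensor_on R dom I}.

Definition indices (R : realType) (Ix : choiceType) (dom : Ix -> finType)
  (A : tensor R dom) : {fset Ix} := tag A.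

Definition entry (R : realType) (Ix : choiceType) (dom : Ix -> finType)
  (A : tensor R dom) (tau : assignment dom (indices A)) : R[i] :=
  (tagged A : {ffun assignment dom (tag A) -> R[i]}) tau.

Definition occurrences (R : realType) (Ix : choiceType) (dom : Ix -> finType)
  (N : {fset tensor R dom}) (i : Ix) : nat :=
  #|` [fset A in N | i \in indices A]|.

Record network (R : realType) (Ix : choiceType) (dom : Ix -> finType) :=
  Network {
  tensors :> {fset tensor R dom};
  _ : tensors != fset0;
  _ : forall i : Ix, (occurrences tensors i <= 2)%N
}.

Definition net_indices (R : realType) (Ix : choiceType) (dom : Ix -> finType)
  (N : network R dom) : {fset Ix} := \bigcup_(A <- tensors N) indices A.

Definition free_indices (R : realType) (Ix : choiceType) (dom : Ix -> finType)
  (N : network R dom) : {fset Ix} :=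
  [fset i in net_indices N | occurrences N i == 1%N].

Definition bond_indices (R : realType) (Ix : choiceType) (dom : Ix -> finType)
  (N : network R dom) : {fset Ix} :=
  [fset i in net_indices N | occurrences N i == 2%N].

Lemma indices_sub (R : realType) (Ix : choiceType) (dom : Ix -> finType)
  (N : network R dom) (A : tensors N) :
  indices (val A) `<=` bond_indices N `|` free_indices N.
Proof.
apply/fsubsetP => i iA.
have iN : i \in net_indices N.
  by apply/bigfcupP; exists (val A); rewrite ?(valP A).
have occ_gt0 : (0 < occurrences N i)%N.
  by rewrite cardfs_gt0; apply/fset0Pn; exists (val A); rewrite !inE (valP A).
case: N A iA iN occ_gt0 => ts ne occ2 A iA iN /=.
rewrite !inE /= iN /=.
by move: (occ2 i); case: (occurrences ts i) => [|[|[|]]].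
Qed.

Lemma in_fsetU_right (Ix : choiceType) (S T : {fset Ix}) (i : S `|` T) :
  val i \notin S -> val i \in T.
Proof. by move=> /negbTE iS; have := valP i; rewrite in_fsetU iS. Qed.

(* [rho `union` tau]; used for disjoint [S] and [T] only. *)
Definition glue (Ix : choiceType) (dom : Ix -> finType) (S T : {fset Ix})
  (rho : assignment dom S) (tau : assignment dom T) :
  assignment dom (S `|` T) :=
  [ffun i : S `|` T =>
    match boolP (val i \in S) with
    | AltTrue iS => rho [` iS]
    | AltFalse iS => tau [` in_fsetU_right iS]
    end : dom (val i)].

Definition restriction (Ix : choiceType) (dom : Ix -> finType) (S T : {fset Ix})
  (ST : S `<=` T) (tau : assignment dom T) : assignment dom S :=
  [ffun i : S => tau (fincl ST i) : dom (val i)].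

Definition contraction (R : realType) (Ix : choiceType) (dom : Ix -> finType)
  (N : network R dom) : {ffun assignment dom (free_indices N) -> R[i]} :=
  [ffun tau => \sum_(rho : assignment dom (bond_indices N))
     \prod_(A : tensors N) entry (restriction (indices_sub A) (glue rho tau))].

(* [(x, true)] is the literal [x], [(x, false)] its negation. *)
Definition literal (X : finType) : Type := (X * bool)%type.
Definition clause (X : finType) : Type := seq (literal X).
Definition cnf (X : finType) : Type := seq (clause X).

Definition cnf_eval (X : finType) (phi : cnf X) (tau : {ffun X -> bool}) :
  bool :=
  all (fun c : clause X => has (fun l : literal X => tau l.1 == l.2) c) phi.

Definition cnf_size (X : finType) (phi : cnf X) : nat :=
  (#|X| + size phi + \sum_(c <- phi) size c)%N.

Definition weighted_count (R : realType) (X : finType) (W : X * bool -> R)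
  (phi : cnf X) : R :=
  \sum_(tau : {ffun X -> bool})
    (cnf_eval phi tau)%:R * \prod_(x : X) W (x, tau x).

(* A unit-cost RAM over the naturals with addition and truncated subtraction  *)
(* only (hence polynomially equivalent to Turing machines), a read-only input *)
(* and a write-only output.  The weights form a second read-only input; they  *)
(* are opaque to the machine, which can only copy them, or the constants 0    *)
(* and 1, to its output: no arithmetic or test on scalars is available.       *)

Inductive expr : Type :=
| Const of nat
| Input of expr
| Mem of expr
| Plus of expr & expr
| Minus of expr & expr.

Inductive scalar_expr : Type :=
| Zero
| One
| Weight of expr.

Inductive command : Type :=
| Skip
| Store of expr & expr     (* [Store a e] writes [e] at address [a] *)
| Emit of expr
| EmitScalar of scalar_expr
| Seq of command & command
| If of expr & command & command   (* the condition holds if nonzero *)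
| While of expr & command.

Inductive token (R : realType) : Type :=
| Word of nat
| Scalar of R[i].

Arguments Word {R} _.

Record state (R : realType) := State {
  memory : nat -> nat;
  output : seq (token R)
}.

Fixpoint eval (inp : seq nat) (m : nat -> nat) (e : expr) : nat :=
  match e with
  | Const n => n
  | Input e1 => nth 0%N inp (eval inp m e1)
  | Mem e1 => m (eval inp m e1)
  | Plus e1 e2 => (eval inp m e1 + eval inp m e2)%N
  | Minus e1 e2 => (eval inp m e1 - eval inp m e2)%N
  end.

Definition eval_scalar (R : realType) (inp : seq nat) (ws : seq R[i])
  (m : nat -> nat) (e : scalar_expr) : R[i] :=
  match e with
  | Zero => 0
  | One => 1
  | Weight e1 => nth 0 ws (eval inp m e1)
  end.

Definition update (m : nat -> nat) (a v : nat) : nat -> nat :=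
  fun b => if b == a then v else m b.

(* [exec inp ws c s s' t]: command [c] takes state [s] to [s'] in [t] steps.  *)
(* Expressions have a size fixed by the program, so that charging one step    *)
(* for each evaluation is correct up to a factor depending on the program.    *)
Inductive exec (R : realType) (inp : seq nat) (ws : seq R[i]) :
  command -> state R -> state R -> nat -> Prop :=
| ExecSkip s : exec inp ws Skip s s 1
| ExecStore a e s :
    exec inp ws (Store a e) s
      (State (update (memory s) (eval inp (memory s) a) (eval inp (memory s) e))
             (output s)) 1
| ExecEmit e s :
    exec inp ws (Emit e) s
      (State (memory s) (rcons (output s) (Word (eval inp (memory s) e)))) 1
| ExecEmitScalar e s :
    exec inp ws (EmitScalar e) s
      (State (memory s)
             (rcons (output s) (Scalar (eval_scalar inp ws (memory s) e)))) 1
| ExecSeq c1 c2 s1 s2 s3 t1 t2 :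
    exec inp ws c1 s1 s2 t1 -> exec inp ws c2 s2 s3 t2 ->
    exec inp ws (Seq c1 c2) s1 s3 (t1 + t2)%N
| ExecIfTrue e c1 c2 s s' t :
    eval inp (memory s) e != 0%N -> exec inp ws c1 s s' t ->
    exec inp ws (If e c1 c2) s s' t.+1
| ExecIfFalse e c1 c2 s s' t :
    eval inp (memory s) e = 0%N -> exec inp ws c2 s s' t ->
    exec inp ws (If e c1 c2) s s' t.+1
| ExecWhileTrue e c s1 s2 s3 t1 t2 :
    eval inp (memory s1) e != 0%N -> exec inp ws c s1 s2 t1 ->
    exec inp ws (While e c) s2 s3 t2 ->
    exec inp ws (While e c) s1 s3 (t1 + t2).+1
| ExecWhileFalse e c s :
    eval inp (memory s) e = 0%N -> exec inp ws (While e c) s s 1.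

Definition runs (R : realType) (P : command) (inp : seq nat) (ws : seq R[i])
  (out : seq (token R)) (t : nat) : Prop :=
  exists m : nat -> nat,
    exec inp ws P (State (fun _ => 0%N) [::]) (State m out) t.

Definition encode_literal (X : finType) (l : literal X) : seq nat :=
  [:: enum_rank l.1 : nat; l.2 : nat].

Definition encode_clause (X : finType) (c : clause X) : seq nat :=
  size c :: flatten [seq encode_literal l | l <- c].

Definition encode_cnf (X : finType) (phi : cnf X) : seq nat :=
  [:: #|X|, size phi & flatten [seq encode_clause c | c <- phi]].

Definition encode_weights (R : realType) (X : finType) (W : X * bool -> R) :
  seq R[i] :=
  flatten [seq [:: (W (x, false))%:C%C; (W (x, true))%:C%C] | x <- enum X].

(* Networks are output over natural-number indices, [i] having the domain     *)
(* {0, ..., d i - 1}.                                                         *)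
Definition ord_dom (d : nat -> nat) (i : nat) : finType := 'I_(d i).

(* Position of the entry at [tau] in the row-major table of a tensor whose    *)
(* indices are listed in the order [js].                                      *)
Definition offset (d : nat -> nat) (I : {fset nat}) (js : seq I)
  (tau : assignment (ord_dom d) I) : nat :=
  foldl (fun k (i : I) => (k * d (val i) + (tau i : 'I_(d (val i))))%N) 0%N js.

(* A tensor is written out in full: its rank, its indices (in some order)     *)
(* with the sizes of their domains, then the table of all its entries.        *)
Definition tensor_code (R : realType) (d : nat -> nat)
  (A : tensor R (ord_dom d)) (w : seq (token R)) : Prop :=
  exists (js : seq (indices A)) (table : seq R[i]),
    [/\ perm_eq js (enum {: indices A}),
        size table = (\prod_(i <- js) d (val i))%N,
        forall tau : assignment (ord_dom d) (indices A),
          nth 0 table (offset js tau) = entry tau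
      & w = Word (size js)
              :: flatten [seq [:: Word (val i); Word (d (val i))] | i <- js]
                 ++ [seq Scalar z | z <- table]].

(* A network is written out as the number of its tensors, then each of its    *)
(* tensors once, in some order.                                               *)
Definition network_code (R : realType) (d : nat -> nat)
  (N : network R (ord_dom d)) (w : seq (token R)) : Prop :=
  exists (As : seq (tensor R (ord_dom d)))
         (code : tensor R (ord_dom d) -> seq (token R)),
    [/\ perm_eq As (tensors N),
        forall A, A \in tensors N -> tensor_code A (code A)
      & w = Word #|` tensors N| :: flatten [seq code A | A <- As]].

(* Main.v *)
(** The network is a circuit laid out along a single horizontal wire, which
   says whether the clause being read is already satisfied.  Each tensor ("gate")
   consumes the current horizontal wire and creates the next one; it may also
   consume the current wire of a variable and create a new one.  There are gates
   that open a variable with its two weights, gates that read one literal of a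
   clause (so that no tensor has rank more than 4, whatever the length of the
   clauses), gates that close a clause, forcing the horizontal wire to be true
   and resetting it, and gates that close a variable.  Given the bits of the
   opened variables, at most one assignment of the wires has a nonzero product
   of entries, so summing the wires out in order of creation yields the weighted
   count.  A tensor of the network is determined by its set of wires because the
   horizontal wire that it consumes occurs in no later tensor. *)

Require Import Defs.
From mathcomp Require Import all_boot all_order all_algebra.
From mathcomp Require Import finmap complex reals boolp zify.

Set Implicit Arguments.
Unset Strict Implicit.
Unset Printing Implicit Defensive.

Import GRing.Theory.

Local Open Scope ring_scope.
Local Open Scope fset_scope.

Local Notation bit s k := (nth false s k).

(** * Tensor networks over binary wires *)

(** Lexicographic order with [false] first, so that a bit list stands at the position that it writes
    in binary. The enumeration thus serves both as a range of summation and as the row-major order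
    of a table. *)
Fixpoint bitseqs (n : nat) : seq bitseq :=
  if n is n'.+1 then
    [seq false :: s | s <- bitseqs n'] ++ [seq true :: s | s <- bitseqs n']
  else [:: [::]].

Lemma mem_bitseqs n s : (s \in bitseqs n) = (size s == n).
Proof.
elim: n s => [|n IHn] [|b s] //=; rewrite mem_cat.
  by apply/orP => -[] /mapP[].
rewrite eqSS -IHn; apply/orP/idP => [[] /mapP[s' s's [_ ->]] //|sn].
by case: b; [right|left]; apply/mapP; exists s.
Qed.

Lemma bitseqs_uniq n : uniq (bitseqs n).
Proof.
elim: n => //= n IHn; rewrite cat_uniq !map_inj_uniq ?IHn; try by move=> ? ? [].
by rewrite andbT; apply/hasPn => _ /mapP[s _ ->]; apply/mapP => -[].
Qed.

Lemma big_bitseqsS (V : nmodType) n (F : bitseq -> V) :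
  \sum_(s <- bitseqs n.+1) F s =
    \sum_(b : bool) \sum_(s <- bitseqs n) F (b :: s).
Proof. by rewrite big_bool big_cat !big_map; exact: addrC. Qed.

Lemma sum_bitseqs (V : nmodType) (T : finType) n (f : T -> bitseq)
    (F : bitseq -> V) :
    injective f -> (forall x, size (f x) = n) ->
    (forall s, size s = n -> exists x, f x = s) ->
  \sum_(x : T) F (f x) = \sum_(s <- bitseqs n) F s.
Proof.
move=> finj fsize fsurj; rewrite -(big_map f xpredT F); apply: perm_big.
apply: uniq_perm; rewrite ?bitseqs_uniq ?map_inj_uniq ?index_enum_uniq // => s.
rewrite mem_bitseqs; apply/mapP/eqP => [[x _ ->] //|/fsurj[x <-]].
by exists x; rewrite ?mem_index_enum.
Qed.

Definition table_index (js : seq nat) (s : bitseq) : nat :=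
  foldl (fun k i => (k * 2 + nth false s i)%N) 0%N js.

Definition tensor_spec (R : realType) : Type := (seq nat * seq R[i])%type.

Definition spec_value (R : realType) (sp : tensor_spec R) (s : bitseq) : R[i] :=
  nth 0 sp.2 (table_index sp.1 s).

Definition spec_code (R : realType) (sp : tensor_spec R) : seq (token R) :=
  Word (size sp.1) :: flatten [seq [:: Word i; Word 2] | i <- sp.1]
    ++ [seq Scalar z | z <- sp.2].

Definition bin (_ : nat) : nat := 2.

Notation bin_dom := (ord_dom bin).

Definition spec_tensor (R : realType) (sp : tensor_spec R) :
    tensor R bin_dom :=
  existT _ [fset i in sp.1]
    ([ffun tau : assignment bin_dom [fset i in sp.1] =>
       nth 0 sp.2 (offset (pmap insub sp.1) tau)]
     : tensor_on R bin_dom [fset i in sp.1]).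

Lemma offset_table_index (I : {fset nat}) (js : seq I)
    (tau : assignment bin_dom I) (s : bitseq) :
    (forall i : I, (tau i : 'I_(bin (val i))) = nth false s (val i) :> nat) ->
  offset js tau = table_index (map val js) s.
Proof.
rewrite /offset /table_index => tauE.
elim/last_ind: js => //= js i IHjs.
by rewrite map_rcons !foldl_rcons IHjs tauE.
Qed.

Lemma val_pmap_insub (I : {fset nat}) (js : seq nat) :
  {subset js <= I} -> [seq val i | i : I <- pmap insub js] = js.
Proof.
elim: js => //= i js IHjs sub; rewrite insubT ?sub ?mem_head //= => iI.
by rewrite IHjs // => j jjs; rewrite sub // in_cons jjs orbT.
Qed.

Lemma spec_tensor_code (R : realType) (sp : tensor_spec R) :
    uniq sp.1 -> size sp.2 = (2 ^ size sp.1)%N ->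
  tensor_code (spec_tensor sp) (spec_code sp).
Proof.
case: sp => js table /= ujs szt.
have valjs : [seq val i | i : [fset i in js] <- pmap insub js] = js.
  by apply: val_pmap_insub => i; rewrite in_fset.
exists (pmap insub js), table; split=> //.
- apply: uniq_perm; rewrite ?enum_uniq ?pmap_sub_uniq // => i.
  rewrite mem_enum inE mem_pmap_sub /=.
  by have := valP i; rewrite in_fset.
- rewrite szt big_const_seq count_predT -(size_map val) valjs iter_muln_1 //.
- by move=> tau; rewrite /entry /= ffunE.
rewrite /spec_code /= -[in LHS]valjs size_map; congr (_ :: flatten _ ++ _).
by rewrite -[in LHS]valjs -map_comp valjs.
Qed.

Definition bits_of (M : nat) (B : {fset nat}) (rho : assignment bin_dom B) :
    bitseq :=
  mkseq (fun i => if insub i is Some j then (rho j == 1%N :> nat) else false) M.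

Lemma nth_bits_of M (B : {fset nat}) (rho : assignment bin_dom B) (i : B) :
  (val i < M)%N -> (rho i : 'I_(bin (val i))) = nth false (bits_of M rho) (val i) :> nat.
Proof.
move=> iM; rewrite nth_mkseq // valK.
by case: (rho i : 'I_(bin (val i))) => -[|[|]].
Qed.

Lemma sum_assignment (V : nmodType) M (B : {fset nat}) (F : bitseq -> V) :
    (forall i, (i \in B) = (i < M)%N) ->
  \sum_(rho : assignment bin_dom B) F (bits_of M rho) =
    \sum_(s <- bitseqs M) F s.
Proof.
move=> BM; apply: sum_bitseqs => [rho rho' eqr|rho|s sM]; rewrite ?size_mkseq //.
  apply/ffunP => i; apply/val_inj.
  by rewrite /= !(nth_bits_of (M := M)) ?eqr -?BM ?(valP i).
exists [ffun i : B => inord (nth false s (val i)) : 'I_(bin (val i))].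
apply/(@eq_from_nth _ false); rewrite ?size_mkseq // => i iM.
rewrite nth_mkseq // insubT ?BM // => iB /=.
by rewrite ffunE /= inordK; case: (nth _ _ _).
Qed.

Lemma spec_tensor_entry (R : realType) M (sp : tensor_spec R) (A : tensor R bin_dom)
    (B F : {fset nat}) (sub : indices A `<=` B `|` F)
    (rho : assignment bin_dom B) (tau : assignment bin_dom F) :
    (forall i, (i \in B) = (i < M)%N) -> F = fset0 ->
    A = spec_tensor sp ->
  entry (restriction sub (glue rho tau)) = spec_value sp (bits_of M rho).
Proof.
move=> BM F0 AE; subst A; rewrite /entry /= ffunE.
have subB i : i \in indices (spec_tensor sp) -> i \in B.
  by move/(fsubsetP sub); rewrite F0 fsetU0.
rewrite (@offset_table_index _ _ _ (bits_of M rho)) => [|i].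
  by rewrite val_pmap_insub // => i; rewrite in_fset.
(* This is the case analysis inside [glue]: as [F] is empty, every wire of the tensor lies in
   [B]. *)
rewrite !ffunE /=; case: {-}_ / boolP => [iB|].
  by apply: (@nth_bits_of M _ rho [` iB]); rewrite -BM.
by move=> iNB; case/negP: (iNB); apply: subB (valP i).
Qed.

(** Reduces the construction to lists: distinct sets of wires give distinct tensors, so passing to a
    finite set loses none, and two occurrences of each wire make all wires bonds. *)
Lemma network_of_specs (R : realType) (sps : seq (tensor_spec R)) (M : nat) :
    sps != [::] ->
    (forall sp, sp \in sps -> uniq sp.1 /\ size sp.2 = (2 ^ size sp.1)%N) ->
    uniq [seq [fset i in sp.1] | sp <- sps] ->
    perm_eq (flatten (map fst sps)) (iota 0 M ++ iota 0 M) ->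
  exists N : network R bin_dom,
    [/\ network_code N (Word (size sps) :: flatten (map (@spec_code R) sps)),
        free_indices N = fset0
      & forall tau : assignment bin_dom (free_indices N),
          contraction N tau =
            \sum_(s <- bitseqs M) \prod_(sp <- sps) spec_value sp s].
Proof.
move=> sps0 spsP usps perm2.
have uA : uniq (map (@spec_tensor R) sps).
  apply: (@map_uniq _ _ (@indices _ _ _)); rewrite -map_comp.
  by rewrite (eq_map (g := fun sp => [fset i in sp.1])).
set N := [fset A in map (@spec_tensor R) sps].
have permN : perm_eq (map (@spec_tensor R) sps) N.
  by apply: uniq_perm => // A; rewrite inE.
(* A list of wires has no repetition, so counting the tensors that contain [i] amounts to counting
   [i] in the concatenated lists. *)
have occ i : occurrences N i = (2 * (i < M))%N.
  transitivity (count_mem i (flatten (map fst sps))); last first.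
    rewrite (permP perm2) count_cat addnn -mul2n count_uniq_mem ?iota_uniq //.
    by rewrite mem_iota.
  transitivity (count (fun A => i \in indices A) (enum_fset N)).
    rewrite -size_filter; apply/perm_size/uniq_perm => [||A]; rewrite ?filter_uniq //.
    by rewrite mem_filter !inE andbC.
  rewrite -(permP permN) count_map.
  elim: (sps) (spsP) => //= sp sps' IHsps spsP'.
  rewrite count_cat IHsps => [|sp' sp's]; last by apply: spsP'; rewrite inE sp's orbT.
  have [usp _] := spsP' sp (mem_head _ _).
  by rewrite (count_uniq_mem _ usp) /= in_fset.
have N0 : N != fset0.
  apply: contraNneq sps0 => N0; rewrite -size_eq0 -(size_map (@spec_tensor R)).
  by rewrite (perm_size permN) N0.
have occ2 i : (occurrences N i <= 2)%N by rewrite occ; case: (i < M)%N.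
exists (Network N0 occ2).
set Nt := Network N0 occ2.
have free0 : free_indices Nt = fset0.
  by apply/fsetP => i; rewrite !inE occ; case: (i < M)%N; rewrite andbF.
have bondE i : (i \in bond_indices Nt) = (i < M)%N.
  rewrite !inE /= occ.
  case iM : (i < M)%N; last by rewrite andbF.
  rewrite andbT; apply/bigfcupP.
  have : (0 < occurrences N i)%N by rewrite occ iM.
  rewrite cardfs_gt0 => /fset0Pn[A]; rewrite !inE => /andP[AN iA].
  by exists A; rewrite // andbT -(perm_mem permN).
(* An inverse of [spec_tensor] on [sps]: codes and entries have to be functions of the tensor. *)
pose spec_of A := nth ([::], [::]) sps (index A (map (@spec_tensor R) sps)).
have spec_ofK : {in sps, cancel (@spec_tensor R) spec_of}.
  move=> sp spP; rewrite /spec_of -[in LHS](nth_index ([::], [::]) spP).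
  have idx : (index sp sps < size sps)%N by rewrite index_mem.
  by rewrite -(nth_map _ (spec_tensor ([::], [::]))) // index_uniq ?size_map // nth_index.
have specK A : A \in N -> spec_of A \in sps /\ A = spec_tensor (spec_of A).
  by rewrite -(perm_mem permN) => /mapP[sp spP ->]; rewrite spec_ofK.
split=> //.
  exists (map (@spec_tensor R) sps), (fun A => spec_code (spec_of A)).
  split=> // [A /specK[/spsP[u sz] {1}->]|]; first exact: spec_tensor_code.
  rewrite -(perm_size permN) size_map -map_comp; congr (_ :: flatten _).
  by apply/eq_in_map => sp spP /=; rewrite spec_ofK.
move=> tau; rewrite ffunE -(sum_assignment _ bondE); apply: eq_bigr => rho _.
transitivity (\prod_(A : Nt) spec_value (spec_of (val A)) (bits_of M rho)).
  by apply: eq_bigr => A _; apply: spec_tensor_entry (proj2 (specK _ (valP A))).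
rewrite -(big_seq_fsetE _ N xpredT (fun A => spec_value (spec_of A) _)).
rewrite -(perm_big _ permN) big_map; apply: eq_big_seq => sp spP.
by rewrite spec_ofK.
Qed.

(** * Circuits *)

Definition table_of (T : Type) (k : nat) (f : bitseq -> T) : seq T :=
  map f (bitseqs k).

Lemma size_bitseqs k : size (bitseqs k) = (2 ^ k)%N.
Proof. by elim: k => //= k IHk; rewrite size_cat !size_map IHk expnS mul2n addnn. Qed.

Lemma table_index_lt js s : (table_index js s < 2 ^ size js)%N.
Proof.
elim/last_ind: js => //= js i IHjs.
rewrite /table_index foldl_rcons size_rcons expnS -/(table_index js s).
by case: (nth false s i) => /=; lia.
Qed.

Lemma foldl_bits (bs : bitseq) a :
  foldl (fun k b => (k * 2 + nat_of_bool b)%N) a bs =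
  (a * 2 ^ size bs + foldl (fun k b => (k * 2 + nat_of_bool b)%N) 0 bs)%N.
Proof.
elim: bs a => [|b bs IHbs] a /=; first by rewrite muln1 addn0.
by rewrite IHbs [in RHS]IHbs expnS; lia.
Qed.

(** The leading bit chooses a half of the enumeration and adds to the position the length of the
    first half, or 0; induction handles the other bits. *)
Lemma nth_bitseqs js s :
  nth [::] (bitseqs (size js)) (table_index js s) = [seq nth false s i | i <- js].
Proof.
have -> : table_index js s =
    foldl (fun k b => (k * 2 + nat_of_bool b)%N) 0 [seq nth false s i | i <- js].
  by elim/last_ind: js => //= js i; rewrite /table_index map_rcons !foldl_rcons => ->.
rewrite -[size js](size_map (nth false s)).
elim: [seq _ | i <- js] => //= b bs IHbs; rewrite foldl_bits.
have lt : (foldl (fun k b => k * 2 + nat_of_bool b) 0 bs < 2 ^ size bs)%N.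
  elim/last_ind: bs {IHbs} => //= bs b' IHbs.
  by rewrite foldl_rcons size_rcons expnS; case: b' => /=; lia.
rewrite nth_cat size_map size_bitseqs; case: b => /=.
  rewrite ifF; last by lia.
  by rewrite mul1n addKn (nth_map [::]) ?size_bitseqs ?IHbs.
by rewrite add0n lt (nth_map [::]) ?size_bitseqs ?IHbs.
Qed.

Lemma spec_value_table (R : realType) js (f : bitseq -> R[i]) s :
  spec_value (js, table_of (size js) f) s = f [seq nth false s i | i <- js].
Proof.
by rewrite /spec_value (nth_map [::]) ?size_bitseqs ?table_index_lt ?nth_bitseqs.
Qed.

(* The state of a circuit under construction is the number [c] of wires       *)
(* created so far and the current wire [cur x] of each variable [x]; the      *)
(* current horizontal wire is always the last one created, [c.-1].            *)
Inductive gate : Type :=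
| Init of nat
| Lit of nat & bool
| EndClause
| Cap of nat.

Definition fresh (g : gate) : nat :=
  match g with Init _ | Lit _ _ => 2 | EndClause | Cap _ => 1 end.

Definition rewire (g : gate) (c : nat) (cur : nat -> nat) : nat -> nat :=
  match g with Init x | Lit x _ => update cur x c | EndClause | Cap _ => cur end.

Definition gate_wires (g : gate) (c : nat) (cur : nat -> nat) : seq nat :=
  match g with
  | Init x => [:: c.-1; c; c.+1]
  | Lit x b => [:: c.-1; cur x; c; c.+1]
  | EndClause => [:: c.-1; c]
  | Cap x => [:: c.-1; cur x; c]
  end.

Definition gate_rank (g : gate) : nat :=
  match g with Init _ | Cap _ => 3 | Lit _ _ => 4 | EndClause => 2 end.

(* The bits of [s] are those of [gate_wires], in the same order. *)
Definition gate_mask (g : gate) (s : bitseq) : bool :=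
  match g with
  | Init _ => bit s 2 == bit s 0
  | Lit _ b => (bit s 2 == bit s 1) && (bit s 3 == bit s 0 || (bit s 1 == b))
  | EndClause => bit s 0 && ~~ bit s 1
  | Cap _ => bit s 2 == bit s 0
  end.

Definition gate_entry (R : realType) (w : nat -> bool -> R[i]) (g : gate)
    (s : bitseq) : R[i] :=
  if gate_mask g s then if g is Init x then w x (bit s 1) else 1 else 0.

Definition gate_spec (R : realType) (w : nat -> bool -> R[i]) (g : gate)
    (c : nat) (cur : nat -> nat) : tensor_spec R :=
  (gate_wires g c cur, table_of (gate_rank g) (gate_entry w g)).

(** The closing tensor gives the last horizontal wire its second occurrence without constraining
    it. *)
Fixpoint gate_specs (R : realType) (w : nat -> bool -> R[i]) (gs : seq gate)
    (c : nat) (cur : nat -> nat) : seq (tensor_spec R) :=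
  if gs is g :: gs' then
    gate_spec w g c cur :: gate_specs w gs' (fresh g + c) (rewire g c cur)
  else [:: ([:: c.-1], [:: 1; 1])].

Definition set_bit (env : nat -> bool) (x : nat) (b : bool) : nat -> bool :=
  fun y => if y == x then b else env y.

(* The sum over the wires created by [gs], given the bit [h] of the current   *)
(* horizontal wire and the bits [env] of the current wires of the variables.  *)
Fixpoint gates_value (R : realType) (w : nat -> bool -> R[i]) (gs : seq gate)
    (h : bool) (env : nat -> bool) : R[i] :=
  match gs with
  | [::] => 1
  | Init x :: gs' => \sum_(b : bool) w x b * gates_value w gs' h (set_bit env x b)
  | Lit x b :: gs' => gates_value w gs' (h || (env x == b)) env
  | EndClause :: gs' => h%:R * gates_value w gs' false env
  | Cap _ :: gs' => gates_value w gs' h env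
  end.

Definition fresh_total (gs : seq gate) : nat := sumn (map fresh gs).

Lemma size_gate_wires g c cur : size (gate_wires g c cur) = gate_rank g.
Proof. by case: g. Qed.

Lemma rewire_lt g c cur :
  (forall x, cur x < c)%N -> forall x, (rewire g c cur x < fresh g + c)%N.
Proof.
move=> cur_lt x; have := cur_lt x.
by case: g => [y|y b||y] /=; rewrite /update; try case: (x == y); lia.
Qed.

Lemma gate_wires_lt g c cur : (0 < c)%N -> (forall x, cur x < c)%N ->
  all (fun i => i < fresh g + c)%N (gate_wires g c cur).
Proof.
move=> c_gt0 cur_lt; apply/allP => i.
by case: g => [x|x b||x] /=; rewrite !inE; repeat case/predU1P=> [->|]; try move/eqP->;
  try have := cur_lt x; lia.
Qed.

(** [s0] holds the bits of the wires created so far. The mask of a gate leaves at most one choice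
    for its fresh bits, except for the variable bit of [Init], which stays free; so the sum over the
    fresh bits collapses to the recursion of [gates_value]. *)
Lemma sum_gate_specs (R : realType) (w : nat -> bool -> R[i]) gs c cur s0 :
    size s0 = c -> (0 < c)%N -> (forall x, cur x < c)%N ->
  \sum_(s <- bitseqs (fresh_total gs))
     \prod_(sp <- gate_specs w gs c cur) spec_value sp (s0 ++ s) =
    gates_value w gs (bit s0 c.-1) (fun x => bit s0 (cur x)).
Proof.
elim: gs c cur s0 => [|g gs IHgs] c cur s0 szs0 c_gt0 cur_lt /=.
  rewrite !big_seq1 cats0 (@spec_value_table _ _ (fun=> 1)) //.
(* The first gate reads only wires below [fresh g + c], so its entry is a constant factor of the sum
   over later wires, to which the induction hypothesis applies with the prefix [s0 ++ s1]. *)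
have step s1 : size s1 = fresh g ->
    \sum_(s <- bitseqs (fresh_total gs))
      \prod_(sp <- gate_specs w (g :: gs) c cur) spec_value sp (s0 ++ s1 ++ s) =
    gate_entry w g [seq bit (s0 ++ s1) i | i <- gate_wires g c cur] *
    gates_value w gs (bit (s0 ++ s1) (fresh g + c).-1)
      (fun x => bit (s0 ++ s1) (rewire g c cur x)).
  move=> szs1.
  have sz01 : size (s0 ++ s1) = (fresh g + c)%N by rewrite size_cat szs0 szs1 addnC.
  rewrite -(IHgs (fresh g + c)%N) //; [|lia|exact: rewire_lt].
  rewrite mulr_sumr; apply: eq_bigr => s _; rewrite big_cons catA; congr (_ * _).
  rewrite /gate_spec -(size_gate_wires g c cur) spec_value_table.
  congr (gate_entry _ _ _); apply/eq_in_map => i iw; rewrite [in LHS]nth_cat ifT //.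
  have := gate_wires_lt g c_gt0 cur_lt; rewrite sz01 => /allP; exact.
have curE (s1 : bitseq) : (fun x => bit (s0 ++ s1) (cur x)) = (fun x => bit s0 (cur x)).
  by apply/funext => x; rewrite nth_cat szs0 cur_lt.
have bitc b s1 : bit (s0 ++ b :: s1) c = b by rewrite nth_cat szs0 ltnn subnn.
have bitc1 b b1 s1 : bit (s0 ++ b :: b1 :: s1) c.+1 = b1.
  by rewrite nth_cat szs0 ltnNge leqnSn /= subSnn.
have bith s1 : bit (s0 ++ s1) c.-1 = bit s0 c.-1 by rewrite nth_cat szs0 ltn_predL c_gt0.
have curS x b s1 : (fun y => bit (s0 ++ b :: s1) (update cur x c y)) =
    set_bit (fun y => bit s0 (cur y)) x b.
  apply/funext => y; rewrite /update /set_bit; case: eqP => // _.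
  by rewrite nth_cat szs0 cur_lt.
have two_fresh k (F : bitseq -> R[i]) : \sum_(s <- bitseqs k.+2) F s =
    \sum_(a : bool) \sum_(b : bool) \sum_(s <- bitseqs k) F [:: a, b & s].
  by rewrite big_bitseqsS; apply: eq_bigr => a _; rewrite big_bitseqsS.
case: g step => [x|x b||x] /= step.
- rewrite two_fresh; apply: eq_bigr => a _.
  under eq_bigr do rewrite (step [:: _; _]) //= !bitc !bitc1 !bith curS /gate_entry /=.
  by rewrite big_bool /=; case: (bit s0 c.-1); rewrite ?mul0r ?addr0 ?add0r.
(* In the mask of [Lit], [||] binds more tightly than [==]: the new horizontal bit equals the
   disjunction of the old one and the literal. *)
- rewrite two_fresh.
  under eq_bigr do under eq_bigr do
    rewrite (step [:: _; _]) //= !bitc !bitc1 !bith nth_cat szs0 cur_lt curS /gate_entry /=.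
  rewrite !big_bool /=.
  (* The new wire of the variable carries the same bit as the old one, so the environment is
     unchanged. *)
  have : set_bit (fun y => bit s0 (cur y)) x (bit s0 (cur x)) =
    (fun y => bit s0 (cur y)).
    by apply/funext => y; rewrite /set_bit; case: eqP => // ->.
  case: (bit s0 (cur x)) => ->; case: (bit s0 c.-1); case: (b);
    by rewrite /= ?mul0r ?mul1r ?addr0 ?add0r.
- rewrite big_bitseqsS.
  under eq_bigr do rewrite (step [:: _]) //= bitc bith curE /gate_entry /=.
  by rewrite big_bool /=; case: (bit s0 c.-1); rewrite ?mul0r ?mul1r ?addr0 ?add0r.
- rewrite big_bitseqsS.
  under eq_bigr do rewrite (step [:: _]) //= bitc bith curE /gate_entry /=.
  by rewrite big_bool /=; case: (bit s0 c.-1); rewrite ?mul0r ?mul1r ?addr0 ?add0r.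
Qed.

(** * Well-formed circuits and the occurrences of their wires *)

Definition gate_ok (g : gate) (L : seq nat) : bool :=
  match g with
  | Init x => x \notin L
  | Lit x _ | Cap x => x \in L
  | EndClause => true
  end.

Definition live (g : gate) (L : seq nat) : seq nat :=
  match g with Init x => x :: L | Cap x => rem x L | _ => L end.

(** [L] lists the open variables, whose current wires await their second occurrence; none may remain
    at the end, as its wire would be free. *)
Fixpoint gates_ok (gs : seq gate) (L : seq nat) : bool :=
  if gs is g :: gs' then gate_ok g L && gates_ok gs' (live g L) else L == [::].

Lemma perm_map_update (cur : nat -> nat) x c L : uniq L -> x \in L ->
  perm_eq (map (update cur x c) L) (c :: map cur (rem x L)).
Proof.
move=> uL xL; have /perm_trans := perm_map (update cur x c) (perm_to_rem xL).
apply; rewrite /= {1}/update eqxx perm_cons.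
have -> // : map (update cur x c) (rem x L) = map cur (rem x L).
apply/eq_in_map => y; rewrite /update mem_rem_uniq // !inE => /andP[/negPf-> _] //.
Qed.

Lemma map_update_notin (cur : nat -> nat) x c L : x \notin L ->
  map (update cur x c) L = map cur L.
Proof.
by move=> xL; apply/eq_in_map => y yL; rewrite /update; case: eqP yL xL => // -> ->.
Qed.

Lemma perm_live g L c (cur : nat -> nat) : uniq L -> gate_ok g L ->
  perm_eq (gate_wires g c cur ++ ((fresh g + c).-1 :: map (rewire g c cur) (live g L)))
          (c.-1 :: map cur L ++ iota c (fresh g) ++ iota c (fresh g)).
Proof.
move=> uL; case: g => [x|x b||x] /= gok; apply/permP => p;
  rewrite /= ?add2n ?add1n ?add0n /= ?count_cat /=.
- rewrite {1}/update eqxx map_update_notin //; lia.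
- rewrite (permP (perm_map_update cur c uL gok)) /=.
  have := permP (perm_map cur (perm_to_rem gok)) p; rewrite /= => ->; lia.
- by lia.
- have := permP (perm_map cur (perm_to_rem gok)) p; rewrite /= => ->; lia.
Qed.

Lemma live_uniq g L : uniq L -> gate_ok g L -> uniq (live g L).
Proof. by case: g => [x|x b||x] //= uL; rewrite ?rem_uniq // => ->. Qed.

(** Iterates [perm_live], until the closing tensor supplies the one occurrence still due. *)
Lemma perm_gate_wires (R : realType) (w : nat -> bool -> R[i]) gs L c cur :
    uniq L -> gates_ok gs L ->
  perm_eq (flatten (map fst (gate_specs w gs c cur)))
    (c.-1 :: map cur L ++ iota c (fresh_total gs) ++ iota c (fresh_total gs)).
Proof.
elim: gs L c cur => [|g gs IHgs] L c cur uL /=; first by move/eqP->.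
case/andP=> gok gsok; rewrite /fresh_total /= -/(fresh_total gs) iotaD.
have /permP IH := IHgs _ (fresh g + c)%N (rewire g c cur) (live_uniq uL gok) gsok.
apply/permP => p; have := permP (perm_live c cur uL gok) p.
have := IH p; rewrite [(c + fresh g)%N]addnC /= !count_cat /= ?count_cat; lia.
Qed.

Lemma gate_wires_uniq g L c cur :
    (0 < c)%N -> (forall x, cur x < c)%N -> uniq (c.-1 :: map cur L) ->
    gate_ok g L ->
  uniq (gate_wires g c cur).
Proof.
move=> c_gt0 cur_lt /= /andP[/negP cL _]; case: g => [x|x b||x] /= gok; rewrite !inE.
- lia.
- have := cur_lt x; have : c.-1 <> cur x by move=> cE; apply: cL; rewrite cE map_f.
  lia.
- lia.
have := cur_lt x; have : c.-1 <> cur x by move=> cE; apply: cL; rewrite cE map_f.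
lia.
Qed.

(** Every gate consumes [c.-1], so this wire is no longer due afterwards, and the wires still due
    stay distinct. This invariant yields distinct wires within a tensor and distinct tensors. *)
Lemma head_notin_live g L c cur :
    (0 < c)%N -> (forall x, cur x < c)%N -> uniq L -> uniq (c.-1 :: map cur L) ->
    gate_ok g L ->
  uniq (c.-1 :: (fresh g + c).-1 :: map (rewire g c cur) (live g L)).
Proof.
move=> c_gt0 cur_lt uL ucL gok.
have add_fresh L' : uniq (c.-1 :: map cur L') ->
    uniq [:: c.-1, c & map cur L'] && uniq [:: c.-1, c.+1, c & map cur L'].
  have notin i : (c <= i)%N -> i \notin map cur L'.
    by move=> ci; apply/mapP => -[x _ iE]; have := cur_lt x; rewrite -iE ltnNge ci.
  rewrite /= !inE => /andP[/negPf-> ->]; rewrite !(negPf (notin _ _)) //; lia.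
have rem_cur x : x \in L -> uniq (c.-1 :: map cur (rem x L)).
  move=> xL; move: ucL; rewrite -(perm_uniq (s1 := c.-1 :: map cur (x :: rem x L))).
    by rewrite /= inE negb_or -!andbA => /and4P[_ -> _ ->].
  by rewrite perm_cons perm_map // perm_sym perm_to_rem.
case: g gok => [x|x b||x] gok; rewrite /= ?add2n ?add1n ?add0n /=.
- rewrite map_update_notin // [update _ _ _ _]/update eqxx.
  by case/andP: (add_fresh _ ucL).
- have cx := perm_map_update cur c uL gok; case/andP: (add_fresh _ (rem_cur _ gok)) => _.
  by rewrite /= !inE !(perm_mem cx) (perm_uniq cx) !inE.
- by case/andP: (add_fresh _ ucL).
by case/andP: (add_fresh _ (rem_cur _ gok)).
Qed.

Lemma gate_specs_ok (R : realType) (w : nat -> bool -> R[i]) gs L c cur :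
    (0 < c)%N -> (forall x, cur x < c)%N -> uniq L -> uniq (c.-1 :: map cur L) ->
    gates_ok gs L ->
  (forall sp, sp \in gate_specs w gs c cur ->
     uniq sp.1 /\ size sp.2 = (2 ^ size sp.1)%N) /\
  uniq [seq [fset i in sp.1] | sp <- gate_specs w gs c cur].
Proof.
elim: gs L c cur => [|g gs IHgs] L c cur c_gt0 cur_lt uL ucL /=.
  by split=> // sp; rewrite inE => /eqP->.
case/andP=> gok gsok.
have := head_notin_live c_gt0 cur_lt uL ucL gok.
rewrite cons_uniq => /andP[c_notin ucL'].
have c'_gt0 : (0 < fresh g + c)%N by rewrite addn_gt0 c_gt0 orbT.
have [okgs ->] := IHgs _ _ _ c'_gt0 (rewire_lt g cur_lt) (live_uniq uL gok) ucL' gsok.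
split.
  move=> sp; rewrite inE => /predU1P[->|]; last exact: okgs.
  rewrite /= size_gate_wires size_map size_bitseqs.
  by split=> //; apply: gate_wires_uniq ucL gok.
(* The wire [c.-1] lies in the first tensor but in no later one: it is not due after the gate, and
   the wires created from then on have larger numbers. *)
rewrite andbT; apply/mapP => -[sp spP /fsetP/(_ c.-1)].
have c_first : c.-1 \in gate_wires g c cur by case: (g) => *; rewrite mem_head.
rewrite !in_fset c_first => /esym c_sp.
have : c.-1 \in flatten (map fst (gate_specs w gs (fresh g + c) (rewire g c cur))).
  by apply/flattenP; exists sp.1; rewrite ?map_f.
rewrite (perm_mem (perm_gate_wires _ _ _ (live_uniq uL gok) gsok)) -cat_cons mem_cat.
rewrite (negPf c_notin) mem_cat orbb mem_iota; lia.
Qed.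

(** * The circuit of a formula *)

Definition clause_gates (cl : seq (nat * bool)) : seq gate :=
  rcons [seq Lit l.1 l.2 | l <- cl] EndClause.

Definition circuit (n : nat) (cls : seq (seq (nat * bool))) : seq gate :=
  map Init (iota 0 n) ++ flatten (map clause_gates cls) ++ map Cap (iota 0 n).

Lemma gates_ok_inits xs gs L : uniq (xs ++ L) ->
  gates_ok (map Init xs ++ gs) L = gates_ok gs (rev xs ++ L).
Proof.
elim: xs L => [|x xs IHxs] L //= /andP[xL uL]; rewrite rev_cons cat_rcons -IHxs.
  by move: xL; rewrite mem_cat negb_or => /andP[_ ->].
by rewrite -[x :: L]cat1s uniq_catCA /= xL.
Qed.

Lemma gates_ok_caps xs L : perm_eq xs L -> gates_ok (map Cap xs) L.
Proof.
elim: xs L => [|x xs IHxs] L /=; first by rewrite perm_sym => /perm_nilP->.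
move=> pL; have xL : x \in L by rewrite -(perm_mem pL) mem_head.
rewrite xL IHxs // -(perm_cons x); exact: perm_trans pL (perm_to_rem xL).
Qed.

Lemma gates_ok_clauses (cls : seq (seq (nat * bool))) gs L :
    all (all (fun l => l.1 \in L)) cls ->
  gates_ok (flatten (map clause_gates cls) ++ gs) L = gates_ok gs L.
Proof.
elim: cls => //= cl cls IHcls /andP[clL /IHcls <-]; rewrite -catA.
rewrite /clause_gates -cats1 -catA /=.
by elim: cl clL => //= l cl IHcl /andP[-> /IHcl].
Qed.

Lemma circuit_ok n cls : all (all (fun l : nat * bool => l.1 < n)%N) cls ->
  gates_ok (circuit n cls) [::].
Proof.
move=> clsn; rewrite gates_ok_inits cats0 ?iota_uniq // gates_ok_clauses.
  by apply: gates_ok_caps; rewrite perm_sym perm_rev.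
apply: sub_all clsn => cl; apply: sub_all => l ln.
by rewrite mem_rev mem_iota.
Qed.

Lemma gates_value_inits (R : realType) (w : nat -> bool -> R[i]) k n gs h env :
  gates_value w (map Init (iota k n) ++ gs) h env =
  \sum_(s <- bitseqs n) (\prod_(i < n) w (k + i)%N (bit s i)) *
    gates_value w gs h
      (fun y => if (k <= y < k + n)%N then bit s (y - k) else env y).
Proof.
elim: n k env => [|n IHn] k env.
  rewrite big_seq1 big_ord0 mul1r; congr gates_value; apply/funext => y.
  by case: ifP => //; lia.
rewrite big_bitseqsS /=; apply: eq_bigr => b _; rewrite IHn mulr_sumr.
apply: eq_bigr => s _; rewrite big_ord_recl /= addn0 mulrA; congr (_ * _ * _).
  by apply: eq_bigr => i _; rewrite /= addnA addn1.
congr gates_value; apply/funext => y; rewrite /set_bit.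
case: (ltngtP k y) => [ky|yk|->].
- by rewrite -(subnSK ky) addnS addSn.

- by [].
by rewrite addnS ltnS leq_addr subnn.
Qed.

(** [EndClause] resets the horizontal bit to [false], so every clause starts afresh and contributes
    its own factor. *)
Lemma gates_value_clauses (R : realType) (w : nat -> bool -> R[i])
    (cls : seq (seq (nat * bool))) gs env :
  gates_value w (flatten (map clause_gates cls) ++ gs) false env =
  (all (has (fun l => env l.1 == l.2)) cls)%:R * gates_value w gs false env.
Proof.
elim: cls => [|cl cls IHcls] /=; first by rewrite mul1r.
(* Within a clause the bit accumulates the disjunction of the literals read, hence the
   generalization to any [h]. *)
have lits h : gates_value w (clause_gates cl ++ (flatten (map clause_gates cls) ++ gs)) h env =
    (h || has (fun l => env l.1 == l.2) cl)%:R *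
      gates_value w (flatten (map clause_gates cls) ++ gs) false env.
  by elim: cl h => [|l cl IHcl] h /=; rewrite ?orbF // IHcl orbA.
by rewrite -catA lits IHcls mulrA -natrM mulnb.
Qed.

Lemma gates_value_caps (R : realType) (w : nat -> bool -> R[i]) xs h env :
  gates_value w (map Cap xs) h env = 1.
Proof. by elim: xs. Qed.

Definition nat_cnf (X : finType) (phi : cnf X) : seq (seq (nat * bool)) :=
  [seq [seq (enum_rank l.1 : nat, l.2) | l <- cl] | cl <- phi].

(** The weights are laid out in pairs, [false] first; [x + x] mirrors the machine, which cannot
    multiply. *)
Definition nth_weight (R : realType) (ws : seq R[i]) (x : nat) (b : bool) : R[i] :=
  nth 0 ws (x + x + b).

Lemma nth_encode_weights (R : realType) (X : finType) (W : X * bool -> R) x b :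
  nth_weight (encode_weights W) (enum_rank x) b = ((W (x, b))%:C)%C.
Proof.
rewrite /nth_weight -[x in RHS](nth_enum_rank x) /encode_weights /=.
have : (enum_rank x < size (enum X))%N by rewrite -cardE.
move: (nat_of_ord (enum_rank x)) => i.
elim: (enum X) i => [|y s IHs] [|i] //= => [_|]; first by case: (b).
by rewrite addnS ltnS => /IHs.
Qed.

(** Bit lists of length [#|X|] are truth assignments read along [enum X]; the [Init] gates
    contribute the weights and the clause gates the truth value. *)
Lemma circuit_value (R : realType) (X : finType) (W : X * bool -> R) (phi : cnf X) env :
  gates_value (nth_weight (encode_weights W)) (circuit #|X| (nat_cnf phi)) false env =
  ((weighted_count W phi)%:C)%C.
Proof.
rewrite gates_value_inits /weighted_count rmorph_sum.
pose f (tau : {ffun X -> bool}) := [seq tau x | x <- enum X].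
have bitf tau x : bit (f tau) (enum_rank x) = tau x.
  by rewrite (nth_map x) ?nth_enum_rank // -cardE.
rewrite -(sum_bitseqs (f := f)) => [|tau tau' ff|tau|s sX].
- apply: eq_bigr => tau _; rewrite gates_value_clauses gates_value_caps mulr1.
  rewrite rmorphM rmorph_prod mulrC; congr (_ * _).
    rewrite rmorph_nat all_map; congr (_ %:R); congr nat_of_bool.
    apply: eq_all => cl /=; rewrite has_map; apply: eq_has => l /=.
    by rewrite add0n ltn_ord subn0 bitf.
  rewrite (reindex _ (onW_bij _ (@enum_rank_bij X))) /=; apply: eq_bigr => x _.
  by rewrite add0n bitf nth_encode_weights.
- by apply/ffunP => x; rewrite -bitf ff bitf.
- by rewrite size_map cardE.
exists [ffun x => bit s (enum_rank x)].
apply/(@eq_from_nth _ false); rewrite size_map -cardE // => i iX.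
have -> : i = enum_rank (enum_val (Ordinal iX)) by rewrite enum_valK.
by rewrite bitf ffunE.
Qed.

(** * The program *)

(** A Hoare triple for total correctness, with [T] bounding the running time. *)
Definition leads (R : realType) (inp : seq nat) (ws : seq R[i]) (c : command)
    (P : state R -> Prop) (T : nat) (Q : state R -> Prop) : Prop :=
  forall s, P s -> exists s' t, [/\ exec inp ws c s s' t, (t <= T)%N & Q s'].

Definition seqs (cs : seq command) : command := foldr Seq Skip cs.

Lemma leads_seq (R : realType) inp (ws : seq R[i]) c1 c2 P Q S T1 T2 :
  leads inp ws c1 P T1 Q -> leads inp ws c2 Q T2 S ->
  leads inp ws (Seq c1 c2) P (T1 + T2) S.
Proof.
move=> H1 H2 s /H1[s1 [t1 [e1 le1 /H2[s2 [t2 [e2 le2 S2]]]]]].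
by exists s2, (t1 + t2)%N; split; [exact: ExecSeq e1 e2 | rewrite leq_add |].
Qed.

Definition stores (aes : seq (nat * expr)) : command :=
  seqs [seq Store (Const ae.1) ae.2 | ae <- aes].

Definition store_all (inp : seq nat) : (nat -> nat) -> seq (nat * expr) -> nat -> nat :=
  foldl (fun m ae => update m ae.1 (eval inp m ae.2)).

Lemma leads_stores (R : realType) inp (ws : seq R[i]) aes (P Q : state R -> Prop) :
    (forall s, P s -> Q (State (store_all inp (memory s) aes) (output s))) ->
  leads inp ws (stores aes) P (size aes).+1 Q.
Proof.
move=> PQ [m out] /PQ /= Qs; exists (State (store_all inp m aes) out), (size aes).+1.
split=> //; elim: aes {PQ Qs} m => [|ae aes IHaes] m /=; first by constructor.
by rewrite -add1n; apply: ExecSeq (IHaes _); constructor.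
Qed.

Lemma leads_le (R : realType) inp (ws : seq R[i]) c T T' (P Q : state R -> Prop) :
  (T <= T')%N -> leads inp ws c P T Q -> leads inp ws c P T' Q.
Proof.
move=> TT' cP s /cP[s' [t [ex le Qs]]]; exists s', t; split=> //.
exact: leq_trans TT'.
Qed.

(** The invariant is indexed by the list of items still to be processed, which ensures termination
    and lets the cost vary with the item; each [.+1] pays for a test of the guard. *)
Lemma leads_while (R : realType) inp (ws : seq R[i]) (A : Type) e c
    (I : seq A -> state R -> Prop) (cost : A -> nat) (l : seq A) :
    (forall l s, I l s -> (eval inp (memory s) e == 0%N) = nilp l) ->
    (forall a l, leads inp ws c (I (a :: l)) (cost a) (I l)) ->
  leads inp ws (While e c) (I l) (sumn [seq (cost a).+1 | a <- l]).+1 (I [::]).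
Proof.
move=> eI cI; elim: l => [|a l IHl] s Is /=.
  by exists s, 1%N; split=> //; apply: ExecWhileFalse; apply/eqP; rewrite (eI _ _ Is).
have [s1 [t1 [e1 le1 /IHl[s2 [t2 [e2 le2 I2]]]]]] := cI _ _ _ Is.
exists s2, (t1 + t2).+1; split=> //; last by lia.
by apply: ExecWhileTrue e1 e2; rewrite (eI _ _ Is).
Qed.

Definition emit (x : expr + scalar_expr) : command :=
  match x with inl e => Emit e | inr e => EmitScalar e end.

Definition eval_token (R : realType) (inp : seq nat) (ws : seq R[i])
    (m : nat -> nat) (x : expr + scalar_expr) : token R :=
  match x with
  | inl e => Word (eval inp m e)
  | inr e => Scalar (eval_scalar inp ws m e)
  end.

Lemma exec_emits (R : realType) inp (ws : seq R[i]) xs m out :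
  exec inp ws (seqs (map emit xs)) (State m out)
    (State m (out ++ map (eval_token inp ws m) xs)) (size xs).+1.
Proof.
elim: xs out => [|x xs IHxs] out /=; first by rewrite cats0; constructor.
rewrite -cat_rcons -add1n; apply: ExecSeq (IHxs _).
by case: x => e; constructor.
Qed.

Lemma leads_emits (R : realType) inp (ws : seq R[i]) xs (P Q : state R -> Prop) :
    (forall m out, P (State m out) ->
       Q (State m (out ++ map (eval_token inp ws m) xs))) ->
  leads inp ws (seqs (map emit xs)) P (size xs).+1 Q.
Proof. by move=> PQ [m out] /PQ Qs; eexists; eexists; split; [exact: exec_emits| |]. Qed.

Definition emit_spec (wires : seq expr) (table : seq scalar_expr) :
    seq (expr + scalar_expr) :=
  inl (Const (size wires)) ::
    flatten [seq [:: inl e; inl (Const 2)] | e <- wires] ++ map inr table.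

Lemma eval_emit_spec (R : realType) inp (ws : seq R[i]) m wires table :
  map (eval_token inp ws m) (emit_spec wires table) =
  spec_code (map (eval inp m) wires, map (eval_scalar inp ws m) table).
Proof.
rewrite /spec_code /= size_map map_cat; congr (_ :: _ ++ _).
  by elim: wires => //= e wires ->.
by rewrite -!map_comp.
Qed.

Notation reg a := (Defs.Mem (Const a)).

(* Registers: 0, the number of wires created so far; 1, an input pointer;     *)
(* 2 and 3, loop counters; 4, the number of literals; 5 + x, the current wire *)
(* of the variable x.                                                         *)
Definition gate_cmd (g : gate) (x : expr) : command :=
  let h := Minus (reg 0) (Const 1) in
  let v := Defs.Mem (Plus (Const 5) x) in
  let wires := match g with
    | Init _ => [:: h; reg 0; Plus (reg 0) (Const 1)]
    | Lit _ _ => [:: h; v; reg 0; Plus (reg 0) (Const 1)]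
    | EndClause => [:: h; reg 0]
    | Cap _ => [:: h; v; reg 0]
    end in
  let entry s :=
    if gate_mask g s then
      if g is Init _ then Weight (Plus (Plus x x) (Const (bit s 1))) else One
    else Zero in
  let move_wire := match g with
    | Init _ | Lit _ _ => Store (Plus (Const 5) x) (reg 0)
    | _ => Skip
    end in
  Seq (seqs (map emit (emit_spec wires (table_of (gate_rank g) entry))))
    (Seq move_wire (Store (Const 0) (Plus (Const (fresh g)) (reg 0)))).

(** The variable is known only at run time, as the value of an expression; the number carried by the
    gate given to [gate_cmd] is a placeholder. *)
Definition with_var (g : gate) (x : nat) : gate :=
  match g with
  | Init _ => Init x
  | Lit _ b => Lit x b
  | EndClause => EndClause
  | Cap _ => Cap x
  end.

Definition var_wire (m : nat -> nat) (x : nat) : nat := m (5 + x)%N.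

(* The invariant of the program: what has been output, followed by the code   *)
(* of the gates still to come, is constant.                                   *)
Definition pending (R : realType) (ws : seq R[i]) (gs : seq gate) (s : state R) :
    seq (token R) :=
  output s ++ flatten (map (@spec_code R)
    (gate_specs (nth_weight ws) gs (memory s 0%N) (var_wire (memory s)))).

(** Registers 1 to 4 are working space: the wires are read from register 0 and from those numbered 5
    or more. *)
Lemma pending_update (R : realType) (ws : seq R[i]) gs m out a v :
  (0 < a < 5)%N ->
  pending ws gs (State (update m a v) out) = pending ws gs (State m out).
Proof.
move=> a5; rewrite /pending /= {1}/update ifF; last by lia.
congr (_ ++ flatten (map _ (gate_specs _ _ _ _))); apply/funext => x.
by rewrite /var_wire /update ifF //; lia.
Qed.

(** [P] depends on registers 1 to 4 only, which the gate does not write, so the data of the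
    surrounding loop survive. *)
Lemma leads_gate (R : realType) inp (ws : seq R[i]) g xe x gs OUT P :
    (forall m m', (forall a, 0 < a < 5 -> m a = m' a)%N -> P m -> P m') ->
    (forall m, P m -> eval inp m xe = x) ->
  leads inp ws (gate_cmd g xe)
    (fun s => P (memory s) /\ pending ws (with_var g x :: gs) s = OUT) 40
    (fun s => P (memory s) /\ pending ws gs s = OUT).
Proof.
move=> Pext Px [m out] /= [Pm <-].
have xE := Px _ Pm.
pose m1 := match g with
  | Init _ | Lit _ _ => update m (5 + x)%N (m 0%N) | _ => m end.
pose out1 := out ++ spec_code (gate_spec (nth_weight ws) (with_var g x) (m 0%N) (var_wire m)).
have m1_0 : m1 0%N = m 0%N by rewrite /m1; case: (g).
pose entry s := if gate_mask g s then
  if g is Init _ then Weight (Plus (Plus xe xe) (Const (bit s 1))) else One else Zero.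
have entryE : map (eval_scalar inp ws m) (table_of (gate_rank g) entry) =
    table_of (gate_rank (with_var g x)) (gate_entry (nth_weight ws) (with_var g x)).
  have -> : gate_rank (with_var g x) = gate_rank g by case: (g).
  rewrite /table_of -map_comp; apply: eq_map => s; rewrite /entry /gate_entry /=.
  have -> : gate_mask (with_var g x) s = gate_mask g s by case: (g).
  by case: (gate_mask g s) => //; case: (g) => //= _; rewrite xE.
have emitted wires :
    map (eval inp m) wires = gate_wires (with_var g x) (m 0%N) (var_wire m) ->
    exec inp ws (seqs (map emit (emit_spec wires (table_of (gate_rank g) entry))))
      (State m out) (State m out1) (size (emit_spec wires (table_of (gate_rank g) entry))).+1.
  move=> wiresE.
  have := exec_emits inp ws (emit_spec wires (table_of (gate_rank g) entry)) m out.
  by rewrite eval_emit_spec wiresE entryE.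
exists (State (update m1 0 (fresh g + m 0))%N out1).
eexists; split.
- apply: ExecSeq; last apply: (@ExecSeq _ _ _ _ _ _ (State m1 out1) _ 1 1).
  + by apply: emitted; case: (g) => *; rewrite /= ?subn1 ?addn1 ?xE.
  + by rewrite /m1; case: (g) => *; rewrite -?xE; constructor.
  + by rewrite -m1_0; constructor.
(* The longest code, that of [Lit], has 1 + 8 + 16 tokens; with the final [Skip] and the two updates
   this makes 28 steps, and 40 is a rounded bound. *)
- by rewrite /emit_spec /= size_cat !size_map size_bitseqs; case: (g).
split=> /=.
  apply: Pext Pm => a a5; rewrite /m1 /update; case: eqP => [|_]; first by lia.
  by case: (g) => *; rewrite // ifF //; lia.
rewrite {1}/pending /= {1}/update /= -[out1 ++ _]catA; congr (_ ++ _).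
rewrite -[RHS]/(spec_code (gate_spec _ (with_var g x) (m 0%N) (var_wire m)) ++
  flatten (map _ (gate_specs _ gs (fresh (with_var g x) + m 0) _))).
have -> : fresh (with_var g x) = fresh g by case: (g).
congr (_ ++ flatten (map _ (gate_specs _ _ _ _))); apply/funext => y.
by rewrite /m1; case: (g) => * /=; rewrite /var_wire /update /= ?eqn_add2l.
Qed.

Lemma leads_weaken (R : realType) inp (ws : seq R[i]) c (P P' Q : state R -> Prop) T :
  (forall s, P s -> P' s) -> leads inp ws c P' T Q -> leads inp ws c P T Q.
Proof. by move=> PP' cP s /PP'/cP. Qed.

Lemma leads_if (R : realType) inp (ws : seq R[i]) e c1 c2 (P Q : state R -> Prop) T :
    leads inp ws c1 (fun s => P s /\ eval inp (memory s) e != 0%N) T Q ->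
    leads inp ws c2 (fun s => P s /\ eval inp (memory s) e = 0%N) T Q ->
  leads inp ws (If e c1 c2) P T.+1 Q.
Proof.
move=> H1 H2 s Ps; case: (eqVneq (eval inp (memory s) e) 0%N) => e0.
  have [s' [t [ex le Qs]]] := H2 s (conj Ps e0).
  by exists s', t.+1; split=> //; apply: ExecIfFalse.
have [s' [t [ex le Qs]]] := H1 s (conj Ps e0).
by exists s', t.+1; split=> //; apply: ExecIfTrue.
Qed.

Lemma sumn_const (T : Type) k (l : seq T) : sumn [seq k | _ <- l] = (k * size l)%N.
Proof. by elim: l => [|a l /= ->]; rewrite ?muln0 ?mulnS. Qed.

(** Truncated subtraction makes the guard a strict comparison of register 2 with the number of
    variables. *)
Definition var_loop (g : gate) : command :=
  While (Minus (Input (Const 0)) (reg 2))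
    (Seq (gate_cmd g (reg 2)) (stores [:: (2%N, Plus (reg 2) (Const 1))])).

Lemma leads_var_loop (R : realType) inp (ws : seq R[i]) g gs OUT :
  leads inp ws (var_loop g)
    (fun s => memory s 2%N = 0%N /\
       pending ws (map (with_var g) (iota 0 (nth 0%N inp 0)) ++ gs) s = OUT)
    (43 * nth 0%N inp 0).+1
    (fun s => pending ws gs s = OUT).
Proof.
set n := nth 0%N inp 0.
pose I l (s : state R) := l = iota (memory s 2%N) (n - memory s 2%N) /\
  pending ws (map (with_var g) l ++ gs) s = OUT.
(* 43 is 40 for the gate, 2 for the increment with its [Skip] and 1 for the guard. *)
have loop l : leads inp ws (var_loop g) (I l) (sumn [seq 43 | _ <- l]).+1 (I [::]).
  apply: (@leads_while _ _ _ _ _ _ I (fun=> 42)) => [l1 s [-> _]|a l1].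
    by rewrite /= /nilp size_iota.
  apply: (leads_weaken (P' := fun s => (memory s 2 = a /\ l1 = iota a.+1 (n - a.+1))%N /\
    pending ws (with_var g a :: (map (with_var g) l1 ++ gs)) s = OUT)).
    move=> s [lE pE]; split; last exact: pE.
    by case nE : (n - memory s 2)%N lE => [|k] //= [-> ->]; rewrite subnS nE.
  apply: (leads_seq (T1 := 40) (T2 := 2)).
    apply: (@leads_gate _ _ _ _ _ _ _ _ (fun m => (m 2 = a /\ l1 = iota a.+1 (n - a.+1))%N)).
      by move=> m m' <-.
    by move=> m [].
  apply: (@leads_stores _ _ _ [:: _]) => -[m out] [[/= m2 l1E] pE].
  by split; rewrite /= ?pending_update // /update /= m2 addn1.
move=> s [s2 sp]; have [//|s' [t [ex le [_ <-]]]] := loop (iota 0 n) s.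
  by split=> //; rewrite s2 subn0.
exists s', t; split=> //; apply: leq_trans le _.
by rewrite sumn_const size_iota.
Qed.

Definition literal_word (l : nat * bool) : seq nat := [:: l.1; nat_of_bool l.2].

Definition clause_word (cl : seq (nat * bool)) : seq nat :=
  size cl :: flatten (map literal_word cl).

Lemma drop_add (T : Type) (p k : nat) (s a r : seq T) :
  drop p s = a ++ r -> size a = k -> drop (p + k) s = r.
Proof. by move=> sE <-; rewrite addnC -drop_drop sE drop_size_cat. Qed.

Lemma nth_drop_cons (T : Type) (x0 x : T) (p : nat) (s r : seq T) :
  drop p s = x :: r -> nth x0 s p = x.
Proof. by move=> sE; rewrite -[p]addn0 -nth_drop sE. Qed.

(** The polarity changes the table of the gate, so the program holds one piece of code for each
    polarity and selects between them. *)
Definition literal_loop : command :=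
  While (reg 3)
    (Seq (If (Input (Plus (reg 1) (Const 1)))
            (gate_cmd (Lit 0 true) (Input (reg 1)))
            (gate_cmd (Lit 0 false) (Input (reg 1))))
      (stores [:: (1%N, Plus (reg 1) (Const 2));
                  (3%N, Minus (reg 3) (Const 1))])).

Lemma leads_literal_loop (R : realType) inp (ws : seq R[i]) cl rest k gs OUT :
  leads inp ws literal_loop
    (fun s => [/\ memory s 3%N = size cl, memory s 2%N = k,
       drop (memory s 1%N) inp = flatten (map literal_word cl) ++ rest
     & pending ws ([seq Lit l.1 l.2 | l <- cl] ++ gs) s = OUT])
    (45 * size cl).+1
    (fun s => (memory s 2%N = k /\ drop (memory s 1%N) inp = rest) /\
       pending ws gs s = OUT).
Proof.
pose I l (s : state R) := [/\ memory s 3%N = size l, memory s 2%N = k,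
  drop (memory s 1%N) inp = flatten (map literal_word l) ++ rest
  & pending ws ([seq Lit l.1 l.2 | l <- l] ++ gs) s = OUT].
have loop l : leads inp ws literal_loop (I l) (sumn [seq 45 | _ <- l]).+1 (I [::]).
  apply: (@leads_while _ _ _ _ _ _ I (fun=> 44)) => [l1 s [/= -> _ _ _] //|[x b] l1].
  pose P (m : nat -> nat) := [/\ m 3 = (size l1).+1, m 2 = k &
    drop (m 1) inp = literal_word (x, b) ++ (flatten (map literal_word l1) ++ rest)]%N.
  pose G := [seq Lit l.1 l.2 | l <- l1] ++ gs.
  have Pext m m' : (forall a, 0 < a < 5 -> m a = m' a)%N -> P m -> P m'.
    by move=> mm'; rewrite /P !mm'.
  have Px m : P m -> eval inp m (Input (reg 1)) = x.
    by case=> _ _ /(@nth_drop_cons _ 0%N) /= ->.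
  have Pb m : P m -> eval inp m (Input (Plus (reg 1) (Const 1))) = b.
    by case=> _ _ /(@drop_add _ _ 1 _ [:: x]) /(_ erefl) /(@nth_drop_cons _ 0%N) /= ->.
  apply: (leads_weaken (P' := fun s => P (memory s) /\
    pending ws (Lit x b :: ([seq Lit l.1 l.2 | l <- l1] ++ gs)) s = OUT)).
    by move=> s [? ? ? ?]; split.
  apply: (leads_seq (T1 := 41) (T2 := 3)).
    apply: leads_if.
      apply: leads_weaken (leads_gate (g := Lit 0 true) (gs := G) (OUT := OUT) Pext Px).
      move=> s [[Ps pE]].
      by rewrite (Pb _ Ps); case: (b) pE.
    apply: leads_weaken (leads_gate (g := Lit 0 false) (gs := G) (OUT := OUT) Pext Px).
    move=> s [[Ps pE]].
    by rewrite (Pb _ Ps); case: (b) pE.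
  apply: (@leads_stores _ _ _ [:: _; _]) => -[m out] /= [[m3 m2 m1] pE].
  split; rewrite /update /= ?pending_update // ?m3 ?subn1 //.
  exact: (@drop_add _ _ 2 _ (literal_word (x, b)) _ m1).
move=> s /loop[s' [t [ex le [_ ? ? ?]]]]; exists s', t; split=> //.
by rewrite -sumn_const.
Qed.

Definition clause_loop : command :=
  While (reg 2)
    (Seq (stores [:: (3%N, Input (reg 1)); (1%N, Plus (reg 1) (Const 1))])
    (Seq literal_loop
    (Seq (gate_cmd EndClause (Const 0))
         (stores [:: (2%N, Minus (reg 2) (Const 1))])))).

Lemma leads_clause_loop (R : realType) inp (ws : seq R[i]) cls gs OUT :
  leads inp ws clause_loop
    (fun s => [/\ memory s 2%N = size cls,
       drop (memory s 1%N) inp = flatten (map clause_word cls)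
     & pending ws (flatten (map clause_gates cls) ++ gs) s = OUT])
    (sumn [seq (45 * size cl + 46).+1 | cl <- cls]).+1
    (fun s => pending ws gs s = OUT).
Proof.
pose I l (s : state R) := [/\ memory s 2%N = size l,
  drop (memory s 1%N) inp = flatten (map clause_word l)
  & pending ws (flatten (map clause_gates l) ++ gs) s = OUT].
have loop l : leads inp ws clause_loop (I l)
    (sumn [seq (45 * size cl + 46).+1 | cl <- l]).+1 (I [::]).
  apply: (leads_while (I := I)) => [l1 s [/= -> _ _] //|cl l1].
  pose G := flatten (map clause_gates l1) ++ gs.
  pose rest := flatten (map clause_word l1).
  (* The summands pay for the two initial stores, the literals, the gate that ends the clause and
     the decrement. *)
  have -> : (45 * size cl + 46 = 3 + ((45 * size cl).+1 + (40 + 2)))%N by lia.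
  apply: leads_seq (leads_seq (leads_literal_loop (cl := cl) (rest := rest)
    (k := size (cl :: l1)) (gs := EndClause :: G) (OUT := OUT)) _).
    apply: (@leads_stores _ _ _ [:: _; _]) => -[m out] [/= m2 m1 pE].
    split; rewrite /update /= ?pending_update //.
    - exact: (@nth_drop_cons _ 0%N _ _ _ _ m1).
    - exact: (@drop_add _ _ 1 _ [:: size cl] _ m1).
    by move: pE; rewrite /clause_gates /= -catA cat_rcons.
  apply: leads_seq.
    apply: (@leads_gate _ _ _ EndClause _ 0%N G OUT
      (fun m => m 2 = size (cl :: l1) /\ drop (m 1) inp = rest)%N) => // m m' mm'.
    by rewrite !mm'.
  apply: (@leads_stores _ _ _ [:: _]) => -[m out] [[/= m2 m1] pE].
  by split; rewrite /update /= ?pending_update // m2 subn1.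
by move=> s /loop[s' [t [ex le [_ _ pE]]]]; exists s', t; split.
Qed.

(** The number of tensors has to be output first, so a preliminary pass adds up the clause sizes; a
    clause occupies one word for its size and two for each literal. *)
Definition count_loop : command :=
  While (reg 2)
    (stores [:: (4%N, Plus (reg 4) (Input (reg 1)));
                (1%N, Plus (Plus (reg 1) (Const 1))
                           (Plus (Input (reg 1)) (Input (reg 1))));
                (2%N, Minus (reg 2) (Const 1))]).

Lemma leads_count_loop (R : realType) inp (ws : seq R[i]) cls :
  leads inp ws count_loop
    (fun s => [/\ memory s 2%N = size cls,
       drop (memory s 1%N) inp = flatten (map clause_word cls),
       memory s 4 = 0%N, var_wire (memory s) = (fun=> 0%N) & output s = [::]])
    (5 * size cls).+1
    (fun s => [/\ memory s 4 = sumn (map size cls),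
       var_wire (memory s) = (fun=> 0%N) & output s = [::]]).
Proof.
pose I (l : seq (seq (nat * bool))) (s : state R) := [/\ memory s 2%N = size l,
  drop (memory s 1%N) inp = flatten (map clause_word l),
  (memory s 4 + sumn (map size l) = sumn (map size cls))%N,
  var_wire (memory s) = (fun=> 0%N) & output s = [::]].
have loop l : leads inp ws count_loop (I l) (sumn [seq 5 | _ <- l]).+1 (I [::]).
  apply: (leads_while (I := I) (cost := fun=> 4)) => [l1 s [/= -> _ _ _ _] //|cl l1].
  apply: (@leads_stores _ _ _ [:: _; _; _]) => -[m out] [/= m2 m1 m4 m5 out0].
  have nth1 := @nth_drop_cons _ 0%N _ _ _ _ m1.
  split; rewrite /update /= ?nth1 ?m2 ?subn1 -?addnA //.
  apply: (@drop_add _ _ _ _ (clause_word cl) _ m1).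
  rewrite /clause_word /= add1n; congr _.+1.
  by elim: (cl) => //= a cl' ->; rewrite addnS.
move=> s [m2 m1 m4 m5 out0]; have [|s' [t [ex le [_ _ m4' m5' out0']]]] := loop cls s.
  by split=> //; rewrite m4.
exists s', t; split=> //; first by rewrite -sumn_const.
by split=> //; rewrite -m4' /= addn0.
Qed.

(** There are two gates for each variable, one for each clause and one for each literal; the 3
    counts the two initial tensors and the closing one. *)
Definition header : seq (expr + scalar_expr) :=
  inl (Plus (Plus (Plus (Input (Const 0)) (Input (Const 0)))
                  (Plus (Input (Const 1)) (reg 4))) (Const 3))
  :: emit_spec [:: Const 0] [:: One; Zero]
  ++ emit_spec [:: Const 0; Const 1] [:: One; Zero; Zero; One].

Definition rewind : command := stores [:: (1%N, Const 2); (2%N, Input (Const 1))].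

(** Register 0 becomes 2 after the header, since the initial tensors already use the wires 0 and
    1. *)
Definition compiler : command :=
  Seq rewind (Seq count_loop (Seq (seqs (map emit header))
  (Seq (stores [:: (0%N, Const 2); (2%N, Const 0)]) (Seq (var_loop (Init 0))
  (Seq rewind (Seq clause_loop
  (Seq (stores [:: (2%N, Const 0)]) (Seq (var_loop (Cap 0))
  (seqs (map emit (emit_spec [:: Minus (reg 0) (Const 1)] [:: One; One]))))))))))).

(* The second tensor is an identity; without it, the closing tensor of an     *)
(* empty formula without variables would have the same wire as the first one. *)
Definition initial_specs (R : realType) : seq (tensor_spec R) :=
  [:: ([:: 0%N], [:: 1; 0]); ([:: 0%N; 1%N], [:: 1; 0; 0; 1])].

Definition cnf_specs (R : realType) (ws : seq R[i]) n cls : seq (tensor_spec R) :=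
  initial_specs R ++ gate_specs (nth_weight ws) (circuit n cls) 2 (fun=> 0%N).

Lemma size_gate_specs (R : realType) (w : nat -> bool -> R[i]) gs c cur :
  size (gate_specs w gs c cur) = (size gs).+1.
Proof. by elim: gs c cur => //= g gs IHgs c cur; rewrite IHgs. Qed.

Lemma size_circuit n cls : size (circuit n cls) = (n + n + (size cls + sumn (map size cls)))%N.
Proof.
rewrite !size_cat !size_map size_iota addnCA addnC; congr (_ + _)%N.
elim: cls => //= cl cls IHcls; rewrite size_cat IHcls size_rcons size_map; lia.
Qed.

Lemma leads_compiler (R : realType) (ws : seq R[i]) n cls :
  leads (n :: size cls :: flatten (map clause_word cls)) ws compiler
    (fun s => s = State (fun=> 0%N) [::])
    (100 * (n + (size cls + sumn (map size cls))).+1)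
    (fun s => output s = Word (size (cnf_specs ws n cls)) ::
                         flatten (map (@spec_code R) (cnf_specs ws n cls))).
Proof.
set inp := n :: _; set OUT := Word _ :: _.
have inits := @leads_var_loop R inp ws (Init 0)
  (flatten (map clause_gates cls) ++ map Cap (iota 0 n)) OUT.
have clauses := @leads_clause_loop R inp ws cls (map Cap (iota 0 n)) OUT.
have caps := @leads_var_loop R inp ws (Cap 0) [::] OUT.
rewrite cats0 in caps.
have nthn : nth 0%N inp 0 = n by [].
rewrite nthn in inits caps.
have clause_time : (sumn [seq (45 * size cl + 46).+1 | cl <- cls] <=
    47 * (size cls + sumn (map size cls)))%N.
  by elim: (cls) => //= cl cls' IHcls; lia.
(* One summand for each part of the program: in all at most 86 steps for each variable, 52 for each
   clause, 47 for each literal and 37 more. *)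
apply: (@leads_le _ _ _ _ (3 + ((5 * size cls).+1 + (16 + (3 + ((43 * n).+1 +
  (3 + ((sumn [seq (45 * size cl + 46).+1 | cl <- cls]).+1 +
  (2 + ((43 * n).+1 + 6)))))))))%N); first by lia.
apply: leads_seq (leads_seq (@leads_count_loop R inp ws cls) _).
  by apply: (@leads_stores _ _ _ [:: _; _]) => _ ->; split; rewrite //= /update /= ?drop0.
apply: (@leads_seq _ _ _ _ _ _ (fun s => var_wire (memory s) = (fun=> 0%N) /\
  output s = Word (size (cnf_specs ws n cls)) ::
             flatten (map (@spec_code R) (initial_specs R)))).
  apply: leads_emits => m out [/= m4 m5 ->]; split=> //=.
  by rewrite m4 size_gate_specs size_circuit /= ; congr (Word _ :: _); lia.
apply: leads_seq (leads_seq inits _).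
  apply: (@leads_stores _ _ _ [:: _; _]) => -[m out] [/= m5 ->]; split=> //.
  by rewrite /OUT /cnf_specs map_cat flatten_cat -[X in gate_specs _ _ _ X]m5.
apply: leads_seq (leads_seq clauses _).
  apply: (@leads_stores _ _ _ [:: _; _]) => -[m out] pE; split; rewrite /= ?pending_update //.
  by rewrite /update /= drop0.
apply: leads_seq (leads_seq caps _).
  by apply: (@leads_stores _ _ _ [:: _]) => -[m out] pE; split; rewrite /= ?pending_update.
apply: leads_emits => m out <-; rewrite eval_emit_spec.
by rewrite /pending /= subn1.
Qed.

(** * The network of a formula and its contraction *)

Lemma encode_nat_cnf (X : finType) (phi : cnf X) :
  encode_cnf phi =
    #|X| :: size (nat_cnf phi) :: flatten (map clause_word (nat_cnf phi)).
Proof.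
rewrite /encode_cnf size_map -map_comp; congr [:: _, _ & flatten _].
by apply: eq_map => cl; rewrite /clause_word /= size_map -map_comp.
Qed.

Lemma cnf_sizeE (X : finType) (phi : cnf X) :
  cnf_size phi = (#|X| + (size (nat_cnf phi) + sumn (map size (nat_cnf phi))))%N.
Proof.
rewrite /cnf_size size_map -addnA sumnE big_map big_map; congr (_ + (_ + _))%N.
by apply: eq_bigr => cl _; rewrite size_map.
Qed.

(** The initial tensors supply both occurrences of wire 0 and the first one of wire 1, which the
    circuit takes as its horizontal wire. *)
Lemma cnf_network (R : realType) (X : finType) (W : X * bool -> R) (phi : cnf X) :
  let sps := cnf_specs (encode_weights W) #|X| (nat_cnf phi) in
  exists N : network R (ord_dom bin),
    [/\ network_code N (Word (size sps) :: flatten (map (@spec_code R) sps)),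
        free_indices N = fset0
      & forall tau : assignment (ord_dom bin) (free_indices N),
          contraction N tau = ((weighted_count W phi)%:C)%C].
Proof.
set gs := circuit #|X| (nat_cnf phi); set w := nth_weight (encode_weights W) => sps.
have gs_ok : gates_ok gs [::].
  apply: circuit_ok; rewrite all_map; apply/allP => cl _ /=.
  by rewrite all_map; apply/allP => l _ /=.
have [specP uniqP] :=
  @gate_specs_ok R w gs [::] 2 (fun=> 0%N) isT (fun=> isT) isT isT gs_ok.
have permP := @perm_gate_wires R w gs [::] 2 (fun=> 0%N) erefl gs_ok.
(* Wire 0 occurs in the initial tensors only, which distinguishes them from all others. *)
have no0 : 0%N \notin flatten (map fst (gate_specs w gs 2 (fun=> 0%N))).
  by rewrite (perm_mem permP) inE /= mem_cat mem_iota.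
have fresh_set sp js : sp \in gate_specs w gs 2 (fun=> 0%N) -> 0%N \in js ->
    [fset i in js] <> [fset i in sp.1].
  move=> spP js0 /fsetP/(_ 0%N); rewrite !in_fset js0 => /esym sp0.
  by case/negP: no0; apply/flattenP; exists sp.1; rewrite ?map_f.
have [//|sp|||N [codeN freeN contrN]] :=
  @network_of_specs R sps (2 + fresh_total gs)%N.
- by rewrite !inE => /or3P[/eqP->|/eqP->|/specP].
- rewrite /= uniqP andbT inE negb_or -andbA; apply/and3P; split.
  + by apply/eqP => /fsetP/(_ 1%N); rewrite !in_fset.
  + by apply/mapP => -[sp spP]; apply: fresh_set.
  by apply/mapP => -[sp spP]; apply: fresh_set.
- apply/seq.permP => p; have := seq.permP permP p.
  by rewrite /= !count_cat /= ?add0n => ->; lia.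
exists N; split=> // tau; rewrite contrN -(circuit_value W phi (fun=> false)).
rewrite big_bitseqsS; under eq_bigr do rewrite big_bitseqsS.
(* The initial tensors force wires 0 and 1 to be [false], so a single term remains, in which the
   circuit starts with an unsatisfied clause. *)
have sumE a b : \sum_(s <- bitseqs (fresh_total gs))
    \prod_(sp <- sps) spec_value sp [:: a, b & s] =
    (~~ a && ~~ b)%:R * gates_value w gs b (fun=> a).
  rewrite -(@sum_gate_specs R w gs 2 (fun=> 0%N) [:: a; b]) // mulr_sumr.
  apply: eq_bigr => s _; rewrite !big_cons mulrA; congr (_ * _).
  by case: a; case: b; rewrite /spec_value /= ?mulr0 ?mulr1 ?mul0r.
under eq_bigr do under eq_bigr do rewrite sumE.
by rewrite !big_bool /= !mul0r mul1r !add0r.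
Qed.

Theorem theorem1 (R : realType) :
  exists (P : command) (p : {poly nat}),
    forall (X : finType) (phi : cnf X) (W : X * bool -> R),
    exists (d : nat -> nat) (N : network R (ord_dom d))
           (out : seq (token R)) (t : nat),
      [/\ runs P (encode_cnf phi) (encode_weights W) out t,
          (t <= p.[cnf_size phi])%N,
          network_code N out,
          free_indices N = fset0
        & forall tau : assignment (ord_dom d) (free_indices N),
            contraction N tau = ((weighted_count W phi)%:C)%C].
Proof.
exists compiler, (100%N%:P * ('X + 1%N%:P)) => X phi W.
have [N [codeN freeN contrN]] := cnf_network W phi.
have [|[m out] [t [ex le outE]]] :=
  @leads_compiler R (encode_weights W) #|X| (nat_cnf phi) (State (fun=> 0%N) [::]).
  by [].
rewrite /= in outE; exists bin, N, out, t; split=> //; last by rewrite outE.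
  by exists m; rewrite encode_nat_cnf.
apply: leq_trans le _; rewrite cnf_sizeE hornerM hornerD hornerX !hornerC.
(* The semiring operations on [nat] are convertible to the usual ones. *)
by rewrite -[X in (_ <= X)%N]/(100 * (_ + 1))%N addn1.
Qed.
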